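(* Let $G$ be a virtually polycyclic group, let $\varphi\in\operatorname{End}(G)$ and let $N\trianglelefteq G$ be a torsion-free normal subgroup of finite index with $\varphi(N)\le N$. For every $[t]_G\in\operatorname{Fix}(P_\varphi)$ choose a representative $t$ and an element $g_t\in G$ with $t=g_t\varphi(t)g_t^{-1}$, and set $C_t:=C_G(t)$, $D_t:=C_N(t)$, $\varphi_t:=\iota_{g_t}\varphi$. Then $$R(\varphi)=\sum_{[t]_G\in\operatorname{Fix}(P_\varphi)}\frac{1}{[C_t:D_t]}\sum_{cD_t\in C_t/D_t}R\big((\iota_c\varphi_t)|_{D_t}\big),$$ as an equality in $\mathbb{N}\cup\{\infty\}$.
   Context: For a group $G$ and $\psi\in\operatorname{End}(G)$, elements $g_1,g_2\in G$ are $\psi$-twisted conjugate if $g_1=hg_2\psi(h)^{-1}$ for some $h\in G$; $R(\psi)\in\mathbb{N}\cup\{\infty\}$ (the Reidemeister number) is the number of equivalence classes. A sum with an infinite term equals $\infty$. For $g\in G$, $\iota_g$ is the inner automorphism $x\mapsto gxg^{-1}$. $\operatorname{Tor}(G)$ is the set of torsion elements of $G$, $[t]_G$ is the $G$-conjugacy class of $t$, $G\backslash\operatorname{Tor}(G)$ is the set of $G$-conjugacy classes of torsion elements (a finite set for virtually polycyclic $G$), and $P_\varphi\colon G\backslash\operatorname{Tor}(G)\to G\backslash\operatorname{Tor}(G)$ is the map $[t]_G\mapsto[\varphi(t)]_G$, with fixed point set $\operatorname{Fix}(P_\varphi)$. $C_G(t)$ is the centraliser of $t$ in $G$ and $C_N(t)=C_G(t)\cap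 N$. The subgroups $C_t$ and $D_t$ are $\varphi_t$-invariant, and $D_t$ is normal of finite index in $C_t$, so for $c\in C_t$ the restriction $(\iota_c\varphi_t)|_{D_t}$ is an endomorphism of $D_t$. *)

(* Defs.v *)
From HB Require Import structures.
From mathcomp Require Import all_boot all_order all_algebra.
From mathcomp Require Import all_classical all_reals all_analysis.

Set Implicit Arguments.
Unset Strict Implicit.
Unset Printing Implicit Defensive.

Local Open Scope classical_set_scope.
Local Open Scope group_scope.

(* Groups may be infinite: [G] is a [groupType] and subgroups of [G] are
   classical sets of type [set G].  Cardinalities and Reidemeister numbers are
   measured by [counting], with values in the extended reals: the number of
   elements of a finite set, +oo for an infinite one. *)

Section Groups.
Variable G : groupType.
Implicit Types (H K N : set G) (g t x y : G) (psi : G -> G).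

Definition subgroup H : Prop := group_closed (mem H).

(* [inn g] is x |-> g x g^-1, whereas MathComp's [x ^ g] is g^-1 x g. *)
Definition inn g x : G := g * x * g^-1.

Definition normal_in H K : Prop :=
  [/\ subgroup H, subgroup K, H `<=` K
    & forall k h, K k -> H h -> H (inn k h)].

Definition lcoset x H : set G := [set x * h | h in H].

Definition lcosets K H : set (set G) := [set lcoset x H | x in K].

Definition finite_index K H : Prop := finite_set (lcosets K H).

Definition group_index (R : realType) K H : \bar R := counting (lcosets K H).

Definition expgz x (k : int) : G :=
  match k with Posz n => x ^+ n | Negz n => x ^- n.+1 end.

(* For [H] normal in [K]: the quotient K / H is cyclic, generated by xH. *)
Definition cyclic_quotient K H : Prop :=
  exists2 x, K x &
    forall y, K y -> exists k : int, lcoset y H = lcoset (expgz x k) H.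

Definition polycyclic K : Prop :=
  exists (n : nat) (s : nat -> set G),
    [/\ s 0 = [set 1], s n = K
      & forall i, (i < n)%N ->
          normal_in (s i) (s i.+1) /\ cyclic_quotient (s i.+1) (s i)].

Definition virtually_polycyclic : Prop :=
  exists H, [/\ subgroup H, finite_index [set: G] H & polycyclic H].

Definition torsion : set G := [set x | exists2 n : nat, (0 < n)%N & x ^+ n = 1].

Definition torsion_free H : Prop := H `&` torsion `<=` [set 1].

Definition centraliser t : set G := [set x | commute x t].

Definition conj_class t : set G := [set inn g t | g in [set: G]].

Definition torsion_classes : set (set G) := [set conj_class t | t in torsion].

(* The map [t] |-> [psi t], without a choice of representative: see
   [class_map_conj_class]. *)
Definition class_map psi (X : set G) : set G :=
  \bigcup_(t in X) conj_class (psi t).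

Definition fixed_torsion_classes psi : set (set G) :=
  [set X | torsion_classes X /\ class_map psi X = X].

(* The psi-twisted conjugacy class of [x] in a subgroup [H] stable under [psi];
   this only depends on the restriction of [psi] to [H]. *)
Definition twisted_class H psi x : set G :=
  [set y | H y /\ exists2 h, H h & y = h * x * (psi h)^-1].

(* The Reidemeister number of the restriction of [psi] to [H]. *)
Definition reidemeister (R : realType) H psi : \bar R :=
  counting [set twisted_class H psi x | x in H].

End Groups.

Arguments group_index {G} R K H.
Arguments reidemeister {G} R H psi.
Arguments virtually_polycyclic : clear implicits.

Lemma innM (G : groupType) (g x y : G) : inn g (x * y) = inn g x * inn g y.
Proof. by rewrite /inn !mulgA mulgVK. Qed.

Lemma inn_comp (G : groupType) (g h x : G) : inn g (inn h x) = inn (g * h) x.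
Proof. by rewrite /inn invgM !mulgA. Qed.

Lemma gmul_morph1 (G : groupType) (phi : {multiplicative G -> G}) : phi 1 = 1.
Proof. by apply: (@mulgI G (phi 1)); rewrite -gmulfM !mulg1. Qed.

Lemma gmul_morphV (G : groupType) (phi : {multiplicative G -> G}) (x : G) :
  phi x^-1 = (phi x)^-1.
Proof. by apply: (@mulgI G (phi x)); rewrite -gmulfM !mulgV gmul_morph1. Qed.

Lemma class_map_conj_class (G : groupType) (phi : {multiplicative G -> G})
  (t : G) : class_map phi (conj_class t) = conj_class (phi t).
Proof.
apply/seteqP; split=> [_ [_ [g _ <-] [h _ <-]]|y ty].
  by exists (h * phi g) => //; rewrite -inn_comp /inn !gmulfM gmul_morphV.
by exists t => //; exists 1 => //; rewrite /inn mul1g invg1 mulg1.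
Qed.

(* The restrictions in the main formula are endomorphisms of C_N(t). *)
Lemma centraliser_stable (G : groupType) (phi : {multiplicative G -> G})
    (N : set G) (t g c : G) :
  normal_in N [set: G] -> (forall x, N x -> N (phi x)) ->
  t = g * phi t * g^-1 -> centraliser t c ->
  forall x, (centraliser t `&` N) x ->
    (centraliser t `&` N) ((inn c \o (inn g \o phi)) x).
Proof.
move=> [_ _ _ nN] phiN tE ct x [xt Nx]; split=> /=; last first.
  by apply/nN => //; apply/nN => //; exact: phiN.
have tg : inn g (phi t) = t by rewrite [RHS]tE.
have tc : inn c t = t by rewrite /inn ct mulgK.
have psiM y z : inn c (inn g (phi (y * z))) =
    inn c (inn g (phi y)) * inn c (inn g (phi z)) by rewrite gmulfM !innM.
have psit : inn c (inn g (phi t)) = t by rewrite tg tc.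
by have := congr1 (fun y => inn c (inn g (phi y))) xt; rewrite !psiM psit.
Qed.

(* Main.v *)
(* For [x] in [G] let [F_x] be the stabiliser of [x] under the twisted action
   [h * x * phi(h)^-1].  If all [F_x] are finite, they consist of torsion
   elements and meet [N] trivially.  One counts the pairs [(x, t)] with [t] in
   [F_x]: for a fixed [t] the admissible [x] form the coset [C_t g_t], whose
   [D_t]-orbits are the classes on the right-hand side, and a [G]-orbit [Gx]
   contributes [[C_t : D_t] |[t] cap F_x| / |F_x|] of them; summing over [t]
   gives 1 for each [G]-orbit.  If R(phi) is infinite, so is the term of the
   class of 1.

   If R(phi) is finite, then all [F_x] are torsion: [F_x] is the group of fixed
   points of [psi = iota_x phi], and R(psi) = R(phi).  The intersections [E_n]
   of all subgroups covered by [n] cosets are fully invariant, of finite index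
   and decrease to 1.  The number of [psi]-twisted classes of [G / E_n] is
   bounded, so for large [n0] every element of [E_n0] is, modulo any [E_n], of
   the form [z * psi(z)^-1].  Hence [z |-> z * psi(z)^-1] induces a bijection
   onto [E_n0 / E_n] from the cosets, in the preimage of [E_n0], of the group of
   fixed points modulo [E_n]; the order of that group in [G / E_n] is thus at
   most [[G : E_n0]], for every [n]. *)

Require Import Defs.
From HB Require Import structures.
From mathcomp Require Import all_boot all_order all_algebra.
From mathcomp Require Import finmap zify.
From mathcomp Require Import all_classical all_reals all_analysis.

Set Implicit Arguments.
Unset Strict Implicit.
Unset Printing Implicit Defensive.

Local Open Scope classical_set_scope.
Local Open Scope ring_scope.
Local Open Scope group_scope.

Import Order.TTheory GRing.Theory Num.Theory.

(** * Counting by sums in the extended reals *)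

Section CountingBySums.
Variable R : realType.
Local Open Scope ereal_scope.

Lemma counting_infinite (T : choiceType) (A : set T) :
  infinite_set A -> counting A = +oo :> \bar R.
Proof. by move=> infA; rewrite /counting asboolF. Qed.

Lemma counting_finite (T : choiceType) (A : set T) :
  finite_set A -> counting A = #|` fset_set A|%:R%:E :> \bar R.
Proof. by move=> finA; rewrite /counting asboolT. Qed.

(** Turns cardinalities into sums, so that reindexing and interchange of sums serve for counting,
    infinite sets included. *)
Lemma counting_esum1 (T : choiceType) (A : set T) :
  counting A = \esum_(i in A) 1 :> \bar R.
Proof.
have sum1 (F : {fset T}) : \sum_(i \in [set` F]) (1 : \bar R) = #|` F|%:R%:E.
  rewrite fsbig_finite//= set_fsetK sumEFin big_const_seq iter_addr_0.
  by rewrite count_predT.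
have [finA|infA] := pselect (finite_set A).
  by rewrite counting_finite// esum_fset// -sum1 fset_setK.
rewrite counting_infinite//; apply/esym/eq_infty => r; apply: esum_ge.
have [F FA rF] := infinite_set_fset (Num.bound `|r|) infA.
exists [set` F]; first by split=> //; exact: finite_fset.
rewrite sum1 lee_fin (le_trans (ler_norm r))// ltW//.
by rewrite (lt_le_trans (archi_boundP _))// ler_nat.
Qed.

Lemma counting_ge0 (T : choiceType) (A : set T) : 0 <= counting A :> \bar R.
Proof. by rewrite counting_esum1; exact: esum_ge0. Qed.

Lemma counting_pos (T : choiceType) (A : set T) a :
  finite_set A -> A a -> exists2 r : R, (0 < r)%R & counting A = r%:E.
Proof.
move=> finA Aa; exists #|` fset_set A|%:R; last exact: counting_finite.
rewrite ltr0n cardfs_gt0; apply/negP => /eqP A0.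
by move: Aa; rewrite -(fset_setK finA) A0.
Qed.

Lemma le_esum1 (T : choiceType) (A : set T) (a : T -> \bar R) i :
  A i -> a i <= \esum_(j in A) a j.
Proof.
move=> Ai; apply: esum_ge; exists [set i]; last by rewrite fsbig_set1.
by split=> [|j ->//]; exact: finite_set1.
Qed.

Lemma esum_swap (I J : choiceType) (A : set I) (B : set J)
    (a : I -> J -> \bar R) :
  (forall i j, A i -> B j -> 0 <= a i j) ->
  \esum_(i in A) \esum_(j in B) a i j = \esum_(j in B) \esum_(i in A) a i j.
Proof.
move=> a0; rewrite (esum_esum a0) esum_esum; last first.
  by move=> j i Bj Ai; exact: a0.
rewrite (reindex_esum (B `*`` fun=> A) _ (fun x => (x.2, x.1)))//; split=> /=.
- by move=> [i j] [].
- by move=> [i j] [i' j'] _ _ [-> ->].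
- by move=> [i j] [Ai Bj]; exists (j, i).
Qed.

Lemma esumZl_pos (I : choiceType) (A : set I) (r : R) (a : I -> \bar R) :
  (0 < r)%R -> (forall i, A i -> 0 <= a i) ->
  \esum_(i in A) (r%:E * a i) = r%:E * \esum_(i in A) a i.
Proof.
have leZ (s : R) (b : I -> \bar R) : (0 < s)%R -> (forall i, A i -> 0 <= b i) ->
    \esum_(i in A) (s%:E * b i) <= s%:E * \esum_(i in A) b i.
  move=> s0 b0; apply: ge_ereal_sup => _ [X [finX XA] <-].
  have -> : \sum_(i \in X) (s%:E * b i) = s%:E * \sum_(i \in X) b i.
    rewrite !fsbig_finite//= !big_seq ge0_sume_distrr// => i.
    by rewrite in_fset_set// inE => /XA/b0.
  rewrite lee_pmul2l ?lte_fin//; apply: esum_ge; exists X => //; split.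
move=> r0 a0; apply/eqP; rewrite eq_le leZ//=.
have ra0 i : A i -> 0 <= r%:E * a i.
  by move=> /a0 ai; rewrite mule_ge0// lee_fin ltW.
have := leZ r^-1%R (fun i => r%:E * a i); rewrite invr_gt0 => /(_ r0 ra0).
under eq_esum do rewrite muleA -EFinM mulVf ?gt_eqF// mul1e.
by rewrite -(@lee_pmul2l _ r%:E) ?lte_fin// muleA -EFinM mulfV ?gt_eqF// mul1e.
Qed.

Lemma esum_cst (T : choiceType) (A : set T) (r : R) :
  (0 < r)%R -> \esum_(i in A) r%:E = r%:E * counting A.
Proof.
move=> r0; rewrite counting_esum1 -esumZl_pos//.
by apply: eq_esum => i _; rewrite mule1.
Qed.

(** [p] names the class of a representative in [I]. As [q] is constant on classes, the set of
    classes is the disjoint union of its fibres over [B]. *)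
Lemma counting_image_fibers (I : Type) (U V : choiceType)
    (p : I -> U) (q : I -> V) (A : set I) (B : set V) :
  (forall i j, A i -> A j -> p i = p j -> q i = q j) ->
  (forall i, A i -> B (q i)) ->
  counting (p @` A) =
    \esum_(b in B) counting (p @` (A `&` q @^-1` [set b])) :> \bar R.
Proof.
move=> pq qB; under eq_esum do rewrite counting_esum1.
rewrite counting_esum1 esum_esum//.
apply: (reindex_esum _ _ (@snd V U) (fun=> 1)).
split=> /=.
- by move=> [b u] /= [_ [i [Ai _] <-]]; exists i.
- move=> [b u] [b' u'] /set_mem/= [_ [i [Ai /= qi] pi]].
  move=> /set_mem/= [_ [j [Aj /= qj] pj]] uu'.
  by rewrite -uu' -qi -qj (pq i j)// pi uu' pj.
- by move=> _ [i Ai <-]; exists (q i, p i) => //=; split; [exact: qB|exists i].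
Qed.

(** [u] induces a bijection between the two sets of classes; its graph [C] projects bijectively onto
    each. *)
Lemma counting_image_bij (I J : Type) (U V : choiceType)
    (p : I -> U) (q : J -> V) (A : set I) (B : set J) (u : I -> J) :
  (forall i, A i -> B (u i)) ->
  (forall i j, A i -> A j -> p i = p j <-> q (u i) = q (u j)) ->
  (forall j, B j -> exists2 i, A i & q (u i) = q j) ->
  counting (p @` A) = counting (q @` B) :> \bar R.
Proof.
move=> uB uE uS; pose C := (fun i => (p i, q (u i))) @` A.
rewrite !counting_esum1.
transitivity (\esum_(x in C) (1 : \bar R)).
  rewrite (reindex_esum C _ fst)//; split.
  - by move=> _ [i Ai <-]; exists i.
  - move=> _ _ /set_mem[i Ai <-] /set_mem[j Aj <-] /= pij.
    by rewrite pij (uE i j Ai Aj).1.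
  - by move=> _ [i Ai <-]; exists (p i, q (u i)) => //; exists i.
rewrite [RHS](reindex_esum C _ snd)//; split.
- by move=> _ [i Ai <-]; exists (u i) => //; exact: uB.
- move=> _ _ /set_mem[i Ai <-] /set_mem[j Aj <-] /= qij.
  by rewrite qij (uE i j Ai Aj).2.
- by move=> _ [j /uS[i Ai <-] <-]; exists (p i, q (u i)) => //; exists i.
Qed.

End CountingBySums.

(** * Finite-index subgroups and their cores *)

Section Subgroups.
Variable G : groupType.
Implicit Types (H K L M : set G) (x y z : G) (n : nat).

Lemma subgroupP H :
  subgroup H <-> H 1 /\ forall x y, H x -> H y -> H (x * y^-1).
Proof.
split=> -[H1 HB]; split; rewrite ?inE//.
- by move: H1; rewrite inE.
- by move=> x y Hx Hy; have := HB x y; rewrite !inE; apply.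
- by move=> x y; rewrite !inE; exact: HB.
Qed.

Lemma subgroup1 H : subgroup H -> H 1.
Proof. by move=> /subgroupP[]. Qed.

Lemma subgroupV H x : subgroup H -> H x -> H x^-1.
Proof. by move=> /subgroupP[H1 HB] Hx; rewrite -[x^-1]mul1g; exact: HB. Qed.

Lemma subgroupM H x y : subgroup H -> H x -> H y -> H (x * y).
Proof.
move=> sH Hx Hy; rewrite -[y]invgK; have /subgroupP[_] := sH.
by apply=> //; exact: subgroupV.
Qed.

Lemma subgroupMr H x y : subgroup H -> H y -> H (x * y) <-> H x.
Proof.
move=> sH Hy; split=> [Hxy|Hx]; last exact: subgroupM.
by rewrite -(mulgK y x); apply: subgroupM => //; exact: subgroupV.
Qed.

Lemma subgroupX H x n : subgroup H -> H x -> H (x ^+ n).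
Proof.
move=> sH Hx; elim: n => [|n IHn]; first exact: subgroup1.
by rewrite expgS; exact: subgroupM.
Qed.

Lemma subgroup_quotC H x y : subgroup H -> H (x^-1 * y) -> H (y^-1 * x).
Proof. by move=> sH /(subgroupV sH); rewrite invgM invgK. Qed.

Lemma subgroup_quot_trans H x y z :
  subgroup H -> H (x^-1 * y) -> H (y^-1 * z) -> H (x^-1 * z).
Proof. by move=> sH /(subgroupM sH) h /h; rewrite mulgA mulgK. Qed.

Lemma subgroupT : subgroup [set: G].
Proof. exact/subgroupP. Qed.

Lemma subgroupI H K : subgroup H -> subgroup K -> subgroup (H `&` K).
Proof.
move=> /subgroupP[H1 HB] /subgroupP[K1 KB]; apply/subgroupP; split=> //.
by move=> x y [Hx Kx] [Hy Ky]; split; [exact: HB|exact: KB].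
Qed.

Lemma subgroup_preimage (psi : {multiplicative G -> G}) H :
  subgroup H -> subgroup (psi @^-1` H).
Proof.
move=> /subgroupP[H1 HB]; apply/subgroupP; split=> [|x y] /=.
  by rewrite gmul_morph1.
by rewrite gmulfM gmul_morphV; exact: HB.
Qed.

Lemma lcosetP x y H : lcoset x H y <-> H (x^-1 * y).
Proof.
split=> [[h Hh <-]|Hxy]; first by rewrite mulKg.
by exists (x^-1 * y) => //; rewrite mulVKg.
Qed.

Lemma lcoset_eqP x y H :
  subgroup H -> lcoset x H = lcoset y H <-> H (x^-1 * y).
Proof.
move=> sH; split=> [xy|Hxy].
  by apply/lcosetP; rewrite xy; apply/lcosetP; rewrite mulVg; exact: subgroup1.
apply/seteqP; split=> z /lcosetP Hz; apply/lcosetP.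
  by apply: subgroup_quot_trans Hz => //; exact: subgroup_quotC.
exact: subgroup_quot_trans Hz.
Qed.

(** With conjugation as an endomorphism, stability of the cores under endomorphisms includes
    normality, and [inn x \o phi] is an endomorphism. *)
HB.instance Definition _ (g : G) :=
  isMultiplicative.Build G G (inn g) (innM g).

(* [K] is contained in a union of [n] left cosets of [L]; the subgroup [L]
   need not lie in [K]. *)
Definition covered K L n : Prop :=
  exists s : 'I_n -> G, forall x, K x -> exists i, L ((s i)^-1 * x).

Lemma covered_preimage (psi : {multiplicative G -> G}) H K L n :
  subgroup L -> (forall x, H x -> K (psi x)) ->
  covered K L n -> covered H (psi @^-1` L) n.
Proof.
move=> sL HK [s sP].
(* A coset that meets the image of [H] gets a representative [psi z] with [z] in [H]; for the others
   the value 1 is a dummy. *)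
have /choice[z zP] (i : 'I_n) : exists z, forall x, H x ->
    L ((s i)^-1 * psi x) -> H z /\ L ((s i)^-1 * psi z).
  have [[z Hz]|nz] := pselect (exists z, H z /\ L ((s i)^-1 * psi z)).
    by exists z.
  by exists 1 => x Hx Lx; case: nz; exists x.
exists z => x Hx; have [i Li] := sP _ (HK _ Hx); exists i => /=.
have [_ Lz] := zP i x Hx Li; rewrite gmulfM gmul_morphV.
by apply: subgroup_quot_trans Li => //; exact: subgroup_quotC.
Qed.

Lemma covered_sub H K L M n :
  H `<=` K -> L `<=` M -> covered K L n -> covered H M n.
Proof.
by move=> HK LM [s sP]; exists s => x /HK/sP[i /LM]; exists i.
Qed.

Lemma covered_leq K L m n : (m <= n)%N -> covered K L m -> covered K L n.
Proof.
move=> mn [s sP].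
exists (fun i : 'I_n => if insub (val i) is Some j then s j else 1).
move=> x /sP[i Li]; exists (widen_ord mn i).
by rewrite -[val (widen_ord mn i)]/(val i) valK.
Qed.

Lemma covered_trans K H L m n :
  covered K H m -> covered H L n -> covered K L (m * n).
Proof.
move=> [s sP] [u uP].
pose v (i : 'I_m * 'I_n) := s i.1 * u i.2.
have mnE : #|{: 'I_m * 'I_n}| = (m * n)%N by rewrite card_prod !card_ord.
exists (fun i => v (enum_val (cast_ord (esym mnE) i))) => x /sP[i /uP[j Lj]].
exists (cast_ord mnE (enum_rank (i, j))).
by rewrite cast_ordK enum_rankK /v /= invgM -mulgA.
Qed.

Lemma finite_index_covered K H :
  subgroup H -> finite_index K H -> exists n, covered K H n.
Proof.
move=> sH /finite_seqP[r rE]; exists (size r).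
have /choice[u uP] (i : 'I_(size r)) : exists x, nth set0 r i = lcoset x H.
  have : [set` r] (nth set0 r i) by rewrite /= mem_nth.
  by rewrite -rE => -[x _ <-]; exists x.
exists u => x Kx.
have rx : lcoset x H \in r.
  by have : lcosets K H (lcoset x H) by [exists x]; rewrite rE.
have ir : (index (lcoset x H) r < size r)%N by rewrite index_mem.
exists (Ordinal ir); apply/(lcoset_eqP _ _ sH).
by rewrite -uP/= nth_index.
Qed.

Lemma covered_expg K L x n : subgroup K -> subgroup L -> covered K L n ->
  K x -> L (x ^+ n`!).
Proof.
move=> sK sL [s sP] Kx.
(* Pigeonhole: two of the n + 1 powers x^0, ..., x^n share a coset, and the difference of their
   exponents, at most n, divides n!. *)
have /choice[f fP] (i : 'I_n.+1) : exists j, L ((s j)^-1 * x ^+ i).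
  by apply: sP; exact: subgroupX.
have [f_inj|] := pselect (injective f).
  by have := leq_card f f_inj; rewrite !card_ord ltnn.
move=> /existsNP[i /existsNP[j /not_implyP[fij ij]]].
wlog ltij : i j fij ij / (i < j)%N.
  move=> wl; case: (ltngtP i j) => [|ji|/val_inj//]; first exact: wl.
  by apply: (wl j i) => // /esym.
have Lij : L (x ^+ (j - i)).
  rewrite expgnFr 1?ltnW// .
  have := fP j; rewrite -fij.
  move=> /(subgroup_quot_trans sL (subgroup_quotC sL (fP i))).
  by rewrite commuteV//; apply/commute_sym/commuteX2.
have /dvdnP[k ->] : (j - i %| n`!)%N.
  rewrite dvdn_fact// subn_gt0 ltij/= leq_subLR.
  by rewrite (leq_trans (leq_ord j))// leq_addl.
by rewrite mulnC expgnA; exact: subgroupX.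
Qed.

(** For K = G this is the E_n of the overview. [L] ranges over subgroups of [G], inside [K] or not,
    so that passing to a smaller [K] or to a preimage stays within the family. *)
Definition core K n : set G :=
  [set x | K x /\ forall L, subgroup L -> covered K L n -> L x].

Lemma core_subgroup K n : subgroup K -> subgroup (core K n).
Proof.
move=> sK; apply/subgroupP; split.
  by split=> [|L sL _]; exact: subgroup1.
move=> x y [Kx Lx] [Ky Ly]; split=> [|L sL cL].
  by apply: subgroupM => //; exact: subgroupV.
by apply: subgroupM => //; [exact: Lx|apply: subgroupV => //; exact: Ly].
Qed.

(** The preimage of [L] is again covered by [n] cosets, so it is one of the subgroups that contain
    [x]. *)
Lemma core_stable (psi : {multiplicative G -> G}) K n x :
  (forall y, K y -> K (psi y)) -> core K n x -> core K n (psi x).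
Proof.
move=> Kpsi [Kx Lx]; split=> [|L sL cL]; first exact: Kpsi.
apply: (Lx (psi @^-1` L)); first exact: subgroup_preimage.
exact: covered_preimage cL.
Qed.

Lemma core_leq K m n : (m <= n)%N -> core K n `<=` core K m.
Proof.
by move=> mn x [Kx Lx]; split=> // L sL /(covered_leq mn); exact: Lx.
Qed.

Lemma sub_core H K n : H `<=` K -> core H n `<=` core K n.
Proof.
move=> HK x [Hx Lx]; split=> [|L sL cL]; first exact: HK.
by apply: Lx => //; exact: covered_sub cL.
Qed.

Lemma core_separated K L n x :
  subgroup L -> covered K L n -> ~ L x -> ~ core K n x.
Proof. by move=> sL cL nLx [_ /(_ L sL cL)]. Qed.

(** The cores have finite index and meet in 1. Both halves are carried together along a polycyclic
    series, because the inductive step for the second uses the first. *)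
Definition profinitely_separated K : Prop :=
  (forall n, exists m, covered K (core K n) m) /\
  (forall x, K x -> x <> 1 -> exists n, ~ core K n x).

Lemma separated1 : profinitely_separated [set 1].
Proof.
split=> [n|x -> []//]; exists 1%N; exists (fun=> 1) => x ->; exists ord0.
rewrite mulVg; apply: (@subgroup1 (core [set 1] n)); apply: core_subgroup.
by apply/subgroupP; split=> // y z -> ->; rewrite /= mulgV.
Qed.

(** [H] itself separates the points outside [H]; a core of [H] has finite index in [K], hence
    separates the points of [H] outside it. *)
Lemma separated_finite_index H K n :
  subgroup H -> H `<=` K -> covered K H n ->
  profinitely_separated H -> profinitely_separated K.
Proof.
move=> sH HK cH [Hfin Hsep]; split=> [k|x Kx x1].
  have [m cm] := Hfin k; exists (n * m)%N.
  apply: covered_sub (covered_trans cH cm) => //.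
  exact: sub_core.
have [Hx|nHx] := pselect (H x); last by exists n; exact: core_separated cH _.
have [k nk] := Hsep _ Hx x1; have [m cm] := Hfin k.
exists (n * m)%N; apply: core_separated (covered_trans cH cm) nk.
exact: core_subgroup.
Qed.

End Subgroups.

(** * Residual finiteness of virtually polycyclic groups *)

Section Polycyclic.
Variable G : groupType.
Implicit Types (H K M : set G) (x y z : G) (n : nat).

(** The cyclic subgroup generated by [x], with integer exponents written as differences of
    naturals. *)
Definition powers x : set G := [set z | exists a b, z = x ^+ a * x ^- b].

Definition prodset H M : set G :=
  [set z | exists a m, [/\ H a, M m & z = a * m]].

Lemma powers_expg x n : powers x (x ^+ n).
Proof. by exists n, 0%N; rewrite expg0 invg1 mulg1. Qed.

Lemma powers_subgroup x : subgroup (powers x).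
Proof.
apply/subgroupP; split=> [|_ _ [a [b ->]] [c [d ->]]].
  exact: (powers_expg x 0).
exists (a + d)%N, (c + b)%N; rewrite invgM invgK !expgnDr invgM !mulgA.
congr (_ * _); rewrite -!mulgA; congr (_ * _).
apply/esym/commuteV; apply: commuteX2; exact: commute_refl.
Qed.

Lemma powers_min H x : subgroup H -> H x -> powers x `<=` H.
Proof.
move=> sH Hx _ [a [b ->]].
by apply: subgroupM => //; last apply: subgroupV => //; exact: subgroupX.
Qed.

Lemma powers_expgz x k : powers x (expgz x k).
Proof.
case: k => n; first exact: powers_expg.
by apply: subgroupV; [exact: powers_subgroup|exact: powers_expg].
Qed.

Lemma powers_modn x z n : (0 < n)%N -> powers x z ->
  exists2 j : 'I_n, True & exists2 e, powers (x ^+ n) e & z = x ^+ j * e.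
Proof.
(* [u] is a natural number congruent to a - b modulo n. *)
move=> n0 [a [b ->]]; set u := (a + n.-1 * b)%N.
exists (Ordinal (ltn_pmod u n0)) => //=.
exists (x ^+ n ^+ (u %/ n) * (x ^+ n) ^- b); first by exists (u %/ n)%N, b.
rewrite -!expgnA mulgA -expgnDr addnC mulnC -divn_eq.
rewrite -[in x ^- (n * b)](prednK n0) mulSn /u !expgnDr invgM.
by rewrite !mulgA mulgK.
Qed.

Lemma prodset_subgroup H M : subgroup H -> subgroup M ->
  (forall h m, H h -> M m -> M (inn h m)) -> subgroup (prodset H M).
Proof.
move=> sH sM nM; apply/subgroupP; split.
  by exists 1, 1; split; rewrite ?mulg1//; exact: subgroup1.
move=> _ _ [a [m [Ha Mm ->]]] [b [n [Hb Mn ->]]].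
exists (a * b^-1), (inn b (m * n^-1)); split.
- by apply: subgroupM => //; exact: subgroupV.
- by apply: nM => //; apply: subgroupM => //; exact: subgroupV.
- by rewrite /inn invgM !mulgA mulgVK.
Qed.

Lemma prodsetl H M : subgroup M -> H `<=` prodset H M.
Proof. by move=> /subgroup1 M1 h Hh; exists h, 1; rewrite mulg1. Qed.

Lemma prodsetr H M : subgroup H -> M `<=` prodset H M.
Proof. by move=> /subgroup1 H1 m Mm; exists 1, m; rewrite mul1g. Qed.

(** * Extensions with cyclic quotient *)

Section CyclicExtension.
Variables (H K : set G) (x : G).
Hypotheses (HnK : normal_in H K) (Kx : K x).
Hypothesis KE : forall y, K y -> exists2 w, powers x w & H (w^-1 * y).

Let sH : subgroup H. Proof. by case: HnK. Qed.
Let sK : subgroup K. Proof. by case: HnK. Qed.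
Let HK : H `<=` K. Proof. by case: HnK. Qed.
Let nH k h : K k -> H h -> H (inn k h).
Proof. by case: HnK => _ _ _; apply. Qed.

Lemma powers_sub y : K y -> powers y `<=` K.
Proof. by move=> Ky; exact: powers_min. Qed.

Lemma powers_prodset_subgroup y : K y -> subgroup (prodset (powers y) H).
Proof.
move=> Ky; apply: prodset_subgroup => //; first exact: powers_subgroup.
by move=> w h /(powers_sub Ky); exact: nH.
Qed.

Lemma covered_powers_prodset n : (0 < n)%N ->
  covered K (prodset (powers (x ^+ n)) H) n.
Proof.
move=> n0; exists (fun i : 'I_n => x ^+ i) => y /KE[w xw Hwy].
have [j _ [e xe wE]] := powers_modn n0 xw; exists j.
by exists e, (w^-1 * y); split=> //; rewrite mulgA wE invgM mulgA mulgV mul1g.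
Qed.

(** Writing e h = (e h e^-1) e moves the power [e], which lies in [E], to the right, so that a
    covering of [H] by cosets of [M] applies. *)
Lemma cyclic_covered M E m n : subgroup E -> M `<=` E -> (0 < n)%N ->
  E (x ^+ n) -> covered H M m -> covered K E (n * m).
Proof.
move=> sE ME n0 Exn [s sP].
apply: covered_trans (covered_powers_prodset n0) _.
exists s => _ [e [h [xe Hh ->]]].
have Ke : K e by apply: powers_sub xe; exact: subgroupX.
have [i Mi] := sP _ (nH Ke Hh); exists i.
rewrite -[e * h](mulgVK e) mulgA; apply: subgroupM => //; first exact: ME.
exact: powers_min xe.
Qed.

Lemma separated_cyclic_extension :
  profinitely_separated H -> profinitely_separated K.
Proof.
move=> sepH; have [Hfin Hsep] := sepH.
(* Either the quotient is finite and [H] has finite index, or no positive power of [x] lies in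
   [H]. *)
have [[n n0 Hxn]|xfree] := pselect (exists2 n, (0 < n)%N & H (x ^+ n)).
  apply: (@separated_finite_index _ H K n) => //.
  apply: covered_sub (covered_powers_prodset n0) => // _ [e [h [xe Hh ->]]].
  by apply: subgroupM => //; exact: powers_min xe.
have sM n : subgroup (core H n) by exact: core_subgroup.
split=> [n|y Ky y1].
  (* The core of [K] contains that of [H] and x^(n!), hence has finite index. *)
  have [m cm] := Hfin n; exists (n`! * m)%N.
  apply: cyclic_covered cm; first exact: core_subgroup.
  - exact: sub_core.
  - exact: fact_gt0.
  - split=> [|L sL cL]; first exact: subgroupX.
    exact: covered_expg cL Kx.
have powers_eq u v : H (x ^+ u * x ^- v) -> u = v.
  wlog vu : u v / (v < u)%N => [wl Huv|Huv].
    case: (ltngtP u v) => // uv; last exact: wl.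
    by apply/esym/wl => //; have := subgroupV sH Huv; rewrite invgM invgK.
  case: xfree; exists (u - v)%N; first by rewrite subn_gt0.
  by rewrite expgnFr// ltnW.
(* The powers of [x] meet [H] only in 1, so their product with a core of [H] meets [H] in that core
   only. *)
have [Hy|nHy] := pselect (H y).
  have [n nMy] := Hsep _ Hy y1; have [m cm] := Hfin n.
  have sE : subgroup (prodset (powers x) (core H n)).
    apply: prodset_subgroup => //; first exact: powers_subgroup.
    move=> w z /(powers_sub Kx) Kw; apply: core_stable => h; exact: nH.
  exists (1 * m)%N; apply: (core_separated sE).
    apply: cyclic_covered cm => //; first exact/prodsetr/powers_subgroup.
    by rewrite expg1; apply: prodsetl => //; exact: (powers_expg x 1).
  move=> [_ [h [[a [b ->]] Mh yE]]]; apply: nMy; move: Hy.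
  rewrite yE; have Hh : H h by case: Mh.
  by move=> /(subgroupMr _ sH Hh)/powers_eq ->; rewrite mulgV mul1g.
have [_ [a [b ->]] Hab] := KE Ky.
have ab : a <> b.
  by move=> ab; apply: nHy; move: Hab; rewrite ab mulgV invg1 mul1g.
have ab0 : (0 < a + b)%N by case: (a) (b) ab => [|?] [|?].
(* [b - a] is nonzero and smaller than [c] in absolute value, hence not a
   multiple of [c] *)
pose c := (2 * (a + b))%N.
have c0 : (0 < c)%N by rewrite muln_gt0.
have Kc : K (x ^+ c) by exact: subgroupX.
exists c; apply: (core_separated (powers_prodset_subgroup Kc)).
  exact: covered_powers_prodset.
move=> [_ [h [[p [q ->]] Hh yE]]].
(* [powers_eq] turns this into b + c p = c q + a. *)
have : H (x ^+ (b + c * p) * x ^- (c * q + a)).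
  move: Hab; rewrite yE mulgA => /(subgroupMr _ sH Hh).
  rewrite invgM invgK -!expgnA !expgnDr invgM -!mulgA.
  rewrite (mulgA (x ^- a)) (mulgA (x ^+ (c * p)) (x ^- a)).
  by rewrite [_ * x ^- a]commuteV//; apply: commuteX2.
move=> /powers_eq; case: (ltngtP p q) => [pq|qp|->]; last first.
- by move=> /eqP; rewrite addnC eqn_add2l => /eqP /esym.
- have : (c * q.+1 <= c * p)%N by rewrite leq_mul2l qp orbT.
  by rewrite mulnS /c; lia.
- have : (c * p.+1 <= c * q)%N by rewrite leq_mul2l pq orbT.
  by rewrite mulnS /c; lia.
Qed.

End CyclicExtension.

Lemma polycyclic_separated K : polycyclic K -> profinitely_separated K.
Proof.
move=> [n [s [s0 <- sS]]].
suff : forall i, (i <= n)%N -> profinitely_separated (s i) by exact.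
elim=> [_|i IHi lein]; first by rewrite s0; exact: separated1.
have [nsi [x six xP]] := sS _ lein.
apply: (separated_cyclic_extension nsi six) (IHi (ltnW lein)) => y /xP[k yE].
exists (expgz x k); first exact: powers_expgz.
by apply/lcoset_eqP; [case: nsi|].
Qed.

Lemma virtually_polycyclic_separated :
  virtually_polycyclic G -> profinitely_separated [set: G].
Proof.
move=> [H [sH Hfin /polycyclic_separated sepH]].
have [n cH] := finite_index_covered sH Hfin.
exact: separated_finite_index cH sepH.
Qed.

End Polycyclic.

(** * Twisted classes and torsion of fixed points *)

Section TwistedClasses.
Variables (G : groupType) (psi : {multiplicative G -> G}).
Implicit Types (H K M E : set G) (x y z h : G) (n : nat).

Definition twist h x : G := h * x * (psi h)^-1.

Lemma twist1 x : twist 1 x = x.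
Proof. by rewrite /twist gmul_morph1 invg1 mul1g mulg1. Qed.

Lemma twistM h k x : twist (h * k) x = twist h (twist k x).
Proof. by rewrite /twist gmulfM invgM !mulgA. Qed.

Lemma twistK h x : twist h^-1 (twist h x) = x.
Proof. by rewrite -twistM mulVg twist1. Qed.

Lemma twistVK h x : twist h (twist h^-1 x) = x.
Proof. by rewrite -twistM mulgV twist1. Qed.

(** Shows that z |-> z psi(z)^-1 respects the cosets of a normal subgroup stable under [psi]: for
    [k] in it, the two values agree modulo it. *)
Lemma twist1_quot h k :
  (twist h 1)^-1 * twist (h * k) 1 = inn (psi h) (twist k 1).
Proof.
by rewrite /twist /inn !mulg1 gmulfM !invgM invgK !mulgA mulgVK.
Qed.

(** The set is not cut down to [H], in contrast to [twisted_class]: D_t will act on the coset C_t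
    g_t. *)
Definition twisted_orbit H x : set G := [set twist h x | h in H].

Lemma twisted_orbit_eqP H x y : subgroup H ->
  twisted_orbit H x = twisted_orbit H y <-> exists2 h, H h & y = twist h x.
Proof.
move=> sH; split=> [xy|[h Hh ->]].
  have : twisted_orbit H y y by exists 1; [exact: subgroup1|exact: twist1].
  by rewrite -xy => -[h Hh <-]; exists h.
apply/seteqP; split=> _ [k Hk <-].
  exists (k * h^-1); last by rewrite twistM twistK.
  by apply: subgroupM => //; exact: subgroupV.
by exists (k * h); [exact: subgroupM|rewrite twistM].
Qed.

Lemma twisted_classT x :
  twisted_class [set: G] psi x = twisted_orbit [set: G] x.
Proof.
apply/seteqP; split=> [_ [_ [h _ ->]]|_ [h _ <-]]; first by exists h.
by split=> //; exists h.
Qed.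

End TwistedClasses.

(** Induction on [n]: if every listed coset has a point of [K] lying in no other one, these points
    form the transversal; otherwise a coset without such a point is redundant and is dropped. *)
Lemma left_transversal (G : groupType) (K M : set G) n :
  subgroup M -> covered K M n ->
  exists q (m : 'I_q -> G), [/\ forall i, K (m i),
    forall i j, M ((m i)^-1 * m j) -> i = j
    & forall x, K x -> exists i, M ((m i)^-1 * x)].
Proof.
move=> sM; elim: n => [[s sP]|n IHn [s sP]].
  by exists 0%N, s; split=> [[]//|[]//|x /sP].
have [priv|] := pselect (forall i, exists x, [/\ K x, M ((s i)^-1 * x)
    & forall j, M ((s j)^-1 * x) -> j = i]).
  have /choice[m mP] := priv; exists n.+1, m; split=> [i|i j Mij|x Kx].
  - by case: (mP i).
  - have [_ Mi mi] := mP i; have [_ Mj mj] := mP j.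
    exact/mj/(subgroup_quot_trans sM Mi).
  - have [i Mi] := sP x Kx; exists i; apply: subgroup_quot_trans Mi => //.
    by apply: subgroup_quotC => //; case: (mP i).
move=> /existsNP[i npriv]; apply: IHn; exists (s \o lift i) => x Kx.
have [j Mj] := sP x Kx.
have [ij|ij] := eqVneq i j; last first.
  by have [k jk _] := unlift_some ij; exists k => /=; rewrite -jk.
have [k ki Mk] : exists2 k, k != i & M ((s k)^-1 * x).
  apply: contra_notP npriv => noM; exists x.
  split=> // [|k Mk]; first by rewrite ij.
  by apply/eqP/negPn/negP => ki; apply: noM; exists k.
have [|l kl _] := @unlift_some _ i k; first by rewrite eq_sym.
by exists l; rewrite /= -kl.
Qed.

(** * Finitely many twisted classes force torsion fixed points *)

Section TorsionFixedPoints.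
Variables (G : groupType) (psi : {multiplicative G -> G}).
Local Notation E := (core [set: G]).
Hypothesis sepG : profinitely_separated [set: G].
Hypothesis finR : finite_set (twisted_orbit psi [set: G] @` [set: G]).

Let sE n : subgroup (E n).
Proof. exact/core_subgroup/subgroupT. Qed.

Let nE n (f : {multiplicative G -> G}) x : E n x -> E n (f x).
Proof. exact: core_stable. Qed.

(** Since E_n is normal, these are the elements of the form z psi(z)^-1 modulo E_n; they make up a
    union of twisted classes. *)
Let B n : set G := [set y | exists z e, E n e /\ y = twist psi z e].

Let B_twist n z y : B n y -> B n (twist psi z y).
Proof. by move=> [w [e [Ee ->]]]; exists (z * w), e; rewrite twistM. Qed.

Let B_leq m n : (m <= n)%N -> B n `<=` B m.
Proof.
by move=> mn _ [z [e [Ee ->]]]; exists z, e; split=> //; exact: core_leq Ee.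
Qed.

(* [B n] decreases with [n] and there are only finitely many twisted classes. *)
Let B_stationary : exists n0, forall n, B n0 `<=` B n.
Proof.
have /finite_seqP[r rE] := finR.
(* [f w] is an index at which the class [w] has left [B], with default 0 if it never does. *)
have /choice[f fP] (w : set G) : exists k, forall y,
    w = twisted_orbit psi [set: G] y -> (exists n, ~ B n y) -> ~ B k y.
  have [[y [k [-> nBk]]]|none] :=
    pselect (exists y k, w = twisted_orbit psi [set: G] y /\ ~ B k y);
    last first.
    by exists 0%N => y wy [k nBk]; case: none; exists y, k.
  exists k => z /(twisted_orbit_eqP _ _ _ (@subgroupT G))[h _ ->] _.
  by move=> /(B_twist h^-1); rewrite twistK.
exists (\max_(w <- r) f w)%N => n y By; apply: contrapT => nBy.
have yr : twisted_orbit psi [set: G] y \in r.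
  have : (twisted_orbit psi [set: G] @` [set: G])
      (twisted_orbit psi [set: G] y) by exists y.
  by rewrite rE.
apply: (fP _ y erefl); first by exists n.
by apply: B_leq By; exact: leq_bigmax_seq.
Qed.

(** [b] bounds the index of E_n0, independently of [n]. If h, ..., h^b all avoided E_n, the q (b +
    1) products z_i h^j, with q = [E_n0 : E_n], would be distinct modulo E_n, although there are at
    most b q cosets. *)
Lemma fixed_expg_core : exists n0 b, forall n h, (n0 <= n)%N -> psi h = h ->
  exists2 k, (0 < k <= b)%N & E n (h ^+ k).
Proof.
have [n0 Bn0] := B_stationary; have [b [S SP]] := sepG.1 n0.
exists n0, b => n h n0n hh; apply: contrapT => noM.
have [c cM] := sepG.1 n.
have cE0 : covered (E n0) (E n) c by apply: covered_sub cM.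
have [q [m [mE m_inj mP]]] := left_transversal (sE n) cE0.
(* As E_n0 lies in [B n], each [m i] is z_i psi(z_i)^-1 modulo E_n. *)
have /choice[z zP] (i : 'I_q) :
    exists z, exists2 e, E n e & m i = twist psi z e.
  have : B n (m i) by apply: Bn0; exists 1, (m i); rewrite twist1.
  by move=> [z [e [Ee me]]]; exists z, e.
pose y (p : 'I_q * 'I_b.+1) := z p.1 * h ^+ p.2.
have /choice[a aP] (p : 'I_q * 'I_b.+1) :
    exists a, E n ((S a.1 * m a.2)^-1 * y p).
  have [i Ei] := SP (y p) I; have [j Ej] := mP _ Ei.
  by exists (i, j); rewrite invgM -mulgA.
have hXk k : psi (h ^+ k) = h ^+ k.
  by elim: k => [|k IHk]; rewrite ?gmul_morph1// expgS gmulfM hh IHk.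
have hX_inj i j : (i <= b)%N -> (j <= b)%N -> E n (h ^- i * h ^+ j) -> i = j.
  wlog ltij : i j / (i < j)%N => [wl ib jb Eij|ib jb Eij].
    case: (ltngtP i j) => // ij; first exact: wl.
    by apply/esym/wl => //; exact: subgroup_quotC.
  case: noM; exists (j - i)%N.
    by rewrite subn_gt0 ltij leq_subLR (leq_trans jb)// leq_addl.
  by rewrite expgnFr 1?ltnW// commuteV//; apply/commute_sym/commuteX2.
(* The map y |-> y psi(y)^-1 forgets the fixed factor h^j and returns [m i] modulo E_n, which
   recovers i; then [hX_inj] recovers j. *)
have a_inj : injective a.
  move=> [i j] [i' j'] aa.
  have Eyy : E n ((y (i, j))^-1 * y (i', j')).
    apply: subgroup_quot_trans (aP (i', j')) => //.
    by apply: subgroup_quotC => //; rewrite -aa.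
  have twy i1 j1 : twist psi (y (i1, j1)) 1 = twist psi (z i1) 1.
    rewrite twistM; congr twist.
    by rewrite /twist/= hXk mulg1 mulgV.
  have mtw i1 : E n ((m i1)^-1 * twist psi (z i1) 1).
    have [e Ee ->] := zP i1; rewrite /twist !invgM invgK !mulgA mulgVK.
    rewrite mulg1; have := nE (inn (psi (z i1))) (subgroupV (sE n) Ee).
    by rewrite /inn.
  have ii : i = i'.
    apply: m_inj; apply: subgroup_quot_trans (mtw i) _ => //.
    apply: subgroup_quot_trans (subgroup_quotC (sE n) (mtw i')) => //.
    rewrite -(twy i j) -(twy i' j').
    rewrite -[y (i', j')](mulVKg (y (i, j))) twist1_quot.
    apply: nE; rewrite /twist mulg1; apply: subgroupM => //.
    by apply: subgroupV => //; exact: nE.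
  move: Eyy; rewrite -ii /y/= invgM mulgA mulgVK => /hX_inj jj.
  by congr (_, _); apply/val_inj/jj; rewrite -ltnS.
have := leq_card a a_inj; rewrite !card_prod !card_ord.
(* The transversal represents 1, so q > 0 and q (b + 1) <= q b is absurd. *)
have [i _] := mP 1 (subgroup1 (sE n0)).
rewrite mulnC leq_pmul2r ?ltnn//; exact: leq_ltn_trans (ltn_ord i).
Qed.

(** Every positive [k] up to [b] divides b!, so h^(b!) lies in all E_n with n >= n0, and these meet
    in 1. *)
Lemma fixed_torsion h : psi h = h -> torsion h.
Proof.
have [n0 [b bP]] := fixed_expg_core.
move=> hh; exists b`!; first exact: fact_gt0.
apply: contrapT => /(sepG.2 _ I)[n]; apply.
apply: (core_leq (leq_maxl n n0)).
have [k kb Ek] := bP (maxn n n0) h (leq_maxr n n0) hh.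
have /dvdnP[l ->] := dvdn_fact kb.
by rewrite mulnC expgnA; exact: subgroupX.
Qed.

End TorsionFixedPoints.

(** * Double counting *)

Section ConjugacyClasses.
Variable G : groupType.
Implicit Types (H K : set G) (x y z s t : G).

Lemma torsion_inn x t : torsion t -> torsion (inn x t).
Proof.
move=> [n n0 tn]; exists n => //.
have innX k : inn x t ^+ k = inn x (t ^+ k).
  elim: k => [|k IHk]; first by rewrite /inn mulg1 mulgV.
  by rewrite !expgS IHk innM.
by rewrite innX tn /inn mulg1 mulgV.
Qed.

Lemma inn1 t : inn 1 t = t.
Proof. by rewrite /inn mul1g invg1 mulg1. Qed.

Lemma torsion1 : torsion (1 : G).
Proof. by exists 1%N. Qed.

Lemma conj_class_refl t : conj_class t t.
Proof. by exists 1; rewrite // /inn mul1g invg1 mulg1. Qed.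

Lemma conj_class_inn x t : conj_class (inn x t) = conj_class t.
Proof.
apply/seteqP; split=> _ [y _ <-].
  by exists (y * x); rewrite // -inn_comp.
by exists (y * x^-1); rewrite // inn_comp mulgVK.
Qed.

Lemma conj_class_eqP s t : conj_class t s <-> conj_class s = conj_class t.
Proof.
split=> [[x _ <-]|<-]; [exact: conj_class_inn|exact: conj_class_refl].
Qed.

Lemma centraliserP t x : centraliser t x <-> inn x t = t.
Proof.
split=> [xt|xt]; first by rewrite /inn xt mulgK.
by rewrite /centraliser/= /commute -[in RHS]xt /inn mulgVK.
Qed.

Lemma centraliser_subgroup t : subgroup (centraliser t).
Proof.
apply/subgroupP; split=> [|x y /centraliserP xt /centraliserP yt].
  by apply/centraliserP; rewrite /inn mul1g invg1 mulg1.
apply/centraliserP; rewrite -inn_comp (_ : inn y^-1 t = t)//.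
by rewrite -{1}yt inn_comp mulVg inn1.
Qed.

Lemma finite_lcosets_capr H K n : subgroup H -> subgroup K ->
  covered [set: G] H n -> finite_set (lcosets K (K `&` H)).
Proof.
move=> sH sK cH.
have cK : covered K H n by apply: covered_sub cH.
have [q [m [mK _ mP]]] := left_transversal sH cK.
apply: (@sub_finite_set _ _ (range (fun i => lcoset (m i) (K `&` H)))).
  move=> _ [x Kx <-]; have [i Hi] := mP _ Kx; exists i => //.
  apply/lcoset_eqP; first exact: subgroupI.
  by split=> //; apply: subgroupM => //; exact: subgroupV.
by apply: finite_image; exact: finite_finset.
Qed.

(** Each coset of [H] contains at most one element of [K]. *)
Lemma finite_capI1 H K n : subgroup H -> subgroup K ->
  covered [set: G] H n -> K `&` H `<=` [set 1] -> finite_set K.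
Proof.
move=> sH sK [s sP] KH1.
have /choice[f fP] (i : 'I_n) :
    exists y, forall x, K x -> H ((s i)^-1 * x) -> x = y.
  have [[y [Ky Hy]]|none] :=
    pselect (exists y, K y /\ H ((s i)^-1 * y)); last first.
    by exists 1 => x Kx Hx; case: none; exists x.
  exists y => x Kx Hx; apply: (mulgI y^-1); rewrite mulVg; apply: KH1; split.
    by apply: subgroupM => //; exact: subgroupV.
  by apply: subgroup_quot_trans Hx => //; exact: subgroup_quotC.
apply: (@sub_finite_set _ _ (range f)) => [x Kx|].
  by have [i Hi] := sP x I; exists i => //; apply/esym/fP.
by apply: finite_image; exact: finite_finset.
Qed.

Definition rcoset H x : set G := [set h * x | h in H].

Lemma rcoset_eqP H x y :
  subgroup H -> rcoset H x = rcoset H y <-> exists2 h, H h & y = h * x.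
Proof.
move=> sH; split=> [xy|[h Hh ->]].
  have : rcoset H y y by exists 1; [exact: subgroup1|rewrite mul1g].
  by rewrite -xy => -[h Hh <-]; exists h.
apply/seteqP; split=> _ [k Hk <-].
  exists (k * h^-1); last by rewrite mulgA mulgVK.
  by apply: subgroupM => //; exact: subgroupV.
by exists (k * h); [exact: subgroupM|rewrite mulgA].
Qed.

End ConjugacyClasses.

(** * Orbits and stabilisers of the twisted action *)

Section DoubleCounting.
Variables (R : realType) (G : groupType) (phi : {multiplicative G -> G}).
Implicit Types (H K : set G) (x y z s t : G).
Local Notation tw := (twist phi).
Local Notation orb := (twisted_orbit phi).

Definition stabiliser x : set G := [set h | tw h x = x].

Lemma stabiliser_subgroup x : subgroup (stabiliser x).
Proof.
apply/subgroupP; split=> [|h k hx kx]; first exact: twist1.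
by rewrite /stabiliser/= twistM -[in LHS]kx twistK.
Qed.

Lemma stabiliser_twist h t x :
  stabiliser (tw h x) t <-> stabiliser x (inn h^-1 t).
Proof.
rewrite /stabiliser/= /inn invgK !twistM.
split=> [->|hx]; first by rewrite twistK.
by move: (congr1 (tw h) hx); rewrite twistVK.
Qed.

(** For fixed [x] this describes the fixed points of iota_x phi; for fixed [t] it will describe the
    coset C_t g_t. *)
Lemma stabiliserP x t : stabiliser x t <-> inn x (phi t) = t.
Proof.
rewrite /stabiliser/= /twist /inn; split=> xt.
  by rewrite -{1}xt mulgVK mulgK.
by rewrite -{1}xt mulgVK mulgK.
Qed.

(** The coset C g is split according to the coset x g^-1 D. Over [Y], with c = [c Y], the map d |->
    d c g carries the twisted action of iota_c iota_g phi on [D] to that of [phi]. *)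
Lemma esum_reidemeister_centraliser (D C : set G) g (c : set G -> G) :
  subgroup C -> normal_in D C -> (forall d, D d -> D (inn g (phi d))) ->
  (forall Y, lcosets C D Y -> Y (c Y)) ->
  (\esum_(Y in lcosets C D) reidemeister R D (inn (c Y) \o (inn g \o phi)) =
   counting (orb D @` [set x | C (x * g^-1)%g]))%E.
Proof.
move=> sC [sD _ DC nD] gD cY.
rewrite (@counting_image_fibers _ _ _ _ _ (fun x => lcoset (x * g^-1) D) _
  (lcosets C D)).
- apply: eq_esum => Y [y Cy yY].
  have [_ [d0 Dd0 c0]] : lcosets C D Y /\ lcoset y D (c Y).
    by split; [exists y|rewrite yY; apply: cY; exists y].
  set psi := _ \o _.
  have Cc : C (c Y) by rewrite -c0; apply: subgroupM => //; exact: DC.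
  have Dcy : D ((c Y)^-1 * y).
    by rewrite -c0 invgM mulgVK; exact: subgroupV.
  have psiD d : D d -> D (psi d) by move=> /gD; exact: nD.
  have twD d h : D d -> D h -> D (twist psi h d).
    move=> Dd Dh; apply: subgroupM => //; first exact: subgroupM.
    by apply: subgroupV => //; exact: psiD.
  have tcE d : D d -> twisted_class D psi d = twisted_orbit psi D d.
    move=> Dd; apply/seteqP.
    split=> [_ [_ [h Dh ->]]|_ [h Dh <-]]; first by exists h.
    by split; [exact: twD|exists h].
  have twE d h : tw h (d * c Y * g) = twist psi h d * c Y * g.
    by rewrite /twist /psi/= /inn !invgM !invgK !mulgA !mulgVK.
  apply: (counting_image_bij _ (u := fun d => d * c Y * g)).
  + move=> d Dd; split=> /=; rewrite mulgK.
      by apply: subgroupM => //; exact: DC.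
    transitivity (lcoset y D) => //; apply/(lcoset_eqP _ _ sD).
    rewrite (_ : _ * y = inn (c Y)^-1 d^-1 * ((c Y)^-1 * y)).
      apply: subgroupM => //; apply: nD; last exact: subgroupV.
      exact: subgroupV.
    by rewrite /inn invgK invgM !mulgA mulgK.
  + move=> d d' Dd Dd'; rewrite !tcE// !twisted_orbit_eqP//; split=> -[h Dh].
      by move=> ->; exists h; rewrite // twE.
    by rewrite twE => /mulIg/mulIg ->; exists h.
  + move=> x [Cx /= xY]; exists (x * g^-1 * (c Y)^-1); last by rewrite !mulgVK.
    rewrite -[_ * _](_ : inn (c Y) ((c Y)^-1 * (x * g^-1)) = _); last first.
      by rewrite /inn mulVKg.
    apply: nD => //; apply: subgroup_quot_trans Dcy _ => //.
    by apply/(lcoset_eqP _ _ sD); rewrite xY.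
(* A [D]-orbit stays over one coset: twisting by [d] changes x g^-1 only by right factors in [D]. *)
- move=> x y Cx Cy /(twisted_orbit_eqP _ _ _ sD)[d Dd ->].
  apply/(lcoset_eqP _ _ sD).
  rewrite (_ : (x * g^-1)^-1 * _ =
      inn (x * g^-1)^-1 d * (inn g (phi d))^-1); last first.
    by rewrite /twist /inn !invgM !invgK !mulgA mulgVK.
  apply: subgroupM => //; first by apply: nD => //; exact: subgroupV.
  by apply: subgroupV => //; exact: gD.
- by move=> x Cx; exists (x * g^-1).
Qed.

Lemma counting_orbits_fibers D t : subgroup D ->
  counting (orb D @` [set x | stabiliser x t]) =
  (\esum_(w in orb [set: G] @` [set: G])
    counting (orb D @` [set y | stabiliser y t /\ orb [set: G] y = w])
  :> \bar R)%E.
Proof.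
move=> sD; apply: counting_image_fibers => [y z _ _|y _]; last by exists y.
move=> /(twisted_orbit_eqP _ _ _ sD)[d _ ->].
by apply/(twisted_orbit_eqP _ _ _ (@subgroupT G)); exists d.
Qed.

(* Both sides count the cosets [D h] such that [h^-1 t h] stabilises [x]: on the
   left through [D h |-> D * (h * x)], on the right through
   [D h |-> h^-1 t h]. *)
Lemma counting_orbits_stabiliser D t x : subgroup D -> D `<=` centraliser t ->
  (forall d, D d -> torsion d -> d = 1) -> stabiliser x `<=` @torsion G ->
  (\esum_(_ in orb D @`
      [set y | stabiliser y t /\ orb [set: G] y = orb [set: G] x])
      counting (stabiliser x) =
   \esum_(_ in conj_class t `&` stabiliser x)
      group_index R (centraliser t) D)%E.
Proof.
move=> sD DC Dtf xtor; have sC := centraliser_subgroup t.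
have sF := stabiliser_subgroup x.
transitivity
  (counting (rcoset D @` [set h | stabiliser x (inn h^-1 t)]) : \bar R).
  rewrite (@counting_image_fibers _ _ _ _ _ (fun h => orb D (tw h x)) _
    (orb D @` [set y | stabiliser y t /\ orb [set: G] y = orb [set: G] x])).
  - apply: eq_esum => _ [y [yt yx] <-].
    have [k _ yE] := (twisted_orbit_eqP _ _ _ (@subgroupT G)).1 (esym yx).
    (* The fibre over the orbit of y = [tw k x] consists of the cosets D k f with f in F_x. *)
    rewrite -[in LHS](@image_id _ (stabiliser x)).
    apply: (counting_image_bij _ (u := fun f => k * f)) =>
      [f xf|f f' xf xf'|h [/= hx]].
    + have kfE : tw (k * f) x = y by rewrite twistM xf -yE.
      by split=> /=; rewrite ?kfE//; apply/stabiliser_twist; rewrite kfE.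
    + split=> [->//|/(rcoset_eqP _ _ sD)[d Dd kE]].
      (* If D k f = D k f', then [d] is conjugate to a torsion element of F_x, hence trivial. *)
      have dE : d = inn k (f' * f^-1).
        by rewrite /inn mulgA kE !mulgA !mulgK.
      have d1 : d = 1.
        apply: Dtf => //; rewrite dE; apply/torsion_inn/xtor.
        by apply: subgroupM => //; exact: subgroupV.
      by move: kE; rewrite d1 mul1g => /mulgI.
    + move=> /esym/(twisted_orbit_eqP _ _ _ sD)[d Dd].
      rewrite yE -twistM => dkx; exists ((d * k)^-1 * h).
        by rewrite /stabiliser/= twistM dkx twistK.
      by apply/(rcoset_eqP _ _ sD); exists d; rewrite // mulgA mulVKg.
  - move=> h h' _ _ /(rcoset_eqP _ _ sD)[d Dd ->].
    by apply/(twisted_orbit_eqP _ _ _ sD); exists d; rewrite // twistM.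
  - move=> h hx; exists (tw h x) => //; split; first exact/stabiliser_twist.
    by apply/esym/(twisted_orbit_eqP _ _ _ (@subgroupT G)); exists h.
rewrite (@counting_image_fibers _ _ _ _ _ (fun h => inn h^-1 t) _
  (conj_class t `&` stabiliser x)).
(* Over s = k t k^-1, inversion turns the left cosets c D into the right cosets D c^-1 k^-1. *)
- apply: eq_esum => s [[k _ ks] xs]; apply/esym.
  apply: (counting_image_bij _ (u := fun c => c^-1 * k^-1)).
  + move=> c /centraliserP ct /=; rewrite invgM !invgK -inn_comp ct.
    by rewrite ks.
  + move=> c c' Cc Cc'; split.
      move=> /(lcoset_eqP _ _ sD) Dcc; apply/(rcoset_eqP _ _ sD).
      exists (c'^-1 * c); first exact: subgroup_quotC.
      by rewrite -mulgA mulVKg.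
    move=> /(rcoset_eqP _ _ sD)[d Dd]; rewrite mulgA => /mulIg cc'.
    apply/(lcoset_eqP _ _ sD); apply: subgroup_quotC => //.
    by rewrite cc' mulgVK.
  + move=> h [/= hx hs]; exists (k^-1 * h^-1).
      by apply/centraliserP; rewrite -inn_comp hs -ks inn_comp mulVg inn1.
    by rewrite invgM !invgK mulgK.
- move=> h h' _ _ /(rcoset_eqP _ _ sD)[d Dd ->].
  rewrite invgM -inn_comp; congr inn; apply/esym/centraliserP.
  by apply: subgroupV => //; exact: DC.
- by move=> h hx; split=> //; exists h^-1.
Qed.

Lemma fixed_torsion_class x t : stabiliser x t -> torsion t ->
  fixed_torsion_classes phi (conj_class t).
Proof.
move=> /stabiliserP xt tt; split; first by exists t.
by rewrite class_map_conj_class -[in RHS]xt conj_class_inn.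
Qed.

Lemma counting_stabiliser_classes x : stabiliser x `<=` @torsion G ->
  (counting (stabiliser x) =
    \esum_(X in fixed_torsion_classes phi) counting (X `&` stabiliser x)
  :> \bar R)%E.
Proof.
move=> xtor; rewrite -[in LHS](@image_id _ (stabiliser x)).
rewrite (@counting_image_fibers _ _ _ _ _ (@conj_class G) _
  (fixed_torsion_classes phi)).
- apply: eq_esum => _ [[t tt <-] _]; rewrite image_id; congr counting.
  apply/seteqP; split=> s [].
    by move=> sx /= st; split=> //; apply/conj_class_eqP.
  by move=> /conj_class_eqP.
- by move=> s s' _ _ ->.
- by move=> s xs; apply: (fixed_torsion_class xs); exact: xtor.
Qed.

Local Open Scope ereal_scope.

Lemma reidemeister_orbits :
  reidemeister R [set: G] phi = counting (orb [set: G] @` [set: G]).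
Proof.
rewrite /reidemeister; congr counting.
by apply: eq_imagel => x _; exact: twisted_classT.
Qed.

(** F_x is the group of fixed points of iota_x phi, and right multiplication by x^-1 carries the
    twisted orbits of [phi] to those of iota_x phi, so finiteness is inherited. *)
Lemma stabiliser_torsion x : virtually_polycyclic G ->
  finite_set (orb [set: G] @` [set: G]) -> stabiliser x `<=` @torsion G.
Proof.
move=> /virtually_polycyclic_separated sepG finR h /stabiliserP hx.
apply: (@fixed_torsion G (inn x \o phi)) => //.
pose f (W : set G) : set G := [set (w * x^-1)%g | w in W].
apply: (@sub_finite_set _ _ (f @` (orb [set: G] @` [set: G]))); last first.
  exact: finite_image.
move=> _ [y _ <-]; exists (orb [set: G] (y * x)%g); first by exists (y * x)%g.
have twE k : (tw k (y * x) * x^-1)%g = twist (inn x \o phi) k y.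
  by rewrite /twist /= /inn !invgM !invgK !mulgA.
apply/seteqP; split=> [_ [_ [k _ <-] <-]|_ [k _ <-]]; first by exists k.
by exists (tw k (y * x)); [exists k|].
Qed.

(** Each [G]-orbit contains at least one [D]-orbit. This serves for t = 1, which stabilises every
    point. *)
Lemma counting_orbits_infty D t : subgroup D -> (forall x, stabiliser x t) ->
  counting (orb [set: G] @` [set: G]) = +oo :> \bar R ->
  counting (orb D @` [set x | stabiliser x t]) = +oo :> \bar R.
Proof.
move=> sD xt infR; apply/eqP; rewrite -leye_eq -infR counting_orbits_fibers//.
rewrite counting_esum1; apply: le_esum => _ [x _ <-].
rewrite counting_esum1; apply: (@le_esum1 _ _ _ (fun=> 1) (orb D x)).
by exists x.
Qed.

End DoubleCounting.

(** * Assembling the formula from the two counts *)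

Theorem theorem3p3 (R : realType) (G : groupType)
  (phi : {multiplicative G -> G}) (N : set G)
  (* for a class X fixed by P_phi: the representative t and the element g_t *)
  (t g : set G -> G)
  (* a representative of each coset Y of D_t in C_t *)
  (c : set G -> set G -> G)
  (Gvpc : virtually_polycyclic G)
  (Nnormal : normal_in N [set: G])
  (Ntf : torsion_free N)
  (Nfin : finite_index [set: G] N)
  (Nphi : forall x, N x -> N (phi x))
  (tX : forall X, fixed_torsion_classes phi X -> X (t X))
  (tg : forall X, fixed_torsion_classes phi X ->
     t X = g X * phi (t X) * (g X)^-1)
  (cY : forall X Y, fixed_torsion_classes phi X ->
     lcosets (centraliser (t X)) (centraliser (t X) `&` N) Y -> Y (c X Y)) :
  (reidemeister R [set: G] phi =
   \esum_(X in fixed_torsion_classes phi)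
     (1 / group_index R (centraliser (t X)) (centraliser (t X) `&` N) *
      \esum_(Y in lcosets (centraliser (t X)) (centraliser (t X) `&` N))
        reidemeister R (centraliser (t X) `&` N)
          (inn (c X Y) \o (inn (g X) \o phi))))%E.
Proof.
have [sN _ _ nN] := Nnormal.
have [n cN] := finite_index_covered sN Nfin.
pose D X := centraliser (t X) `&` N.
have sC X : subgroup (centraliser (t X)) by exact: centraliser_subgroup.
have sD X : subgroup (D X) by exact: subgroupI.
have DC X : D X `<=` centraliser (t X) by move=> ? [].
have Dtf X d : D X d -> torsion d -> d = 1 by move=> [_ Nd] dt; exact: Ntf.
have nD X : normal_in (D X) (centraliser (t X)).
  split=> // k d Ck [Cd Nd]; split; last exact: nN.
  by apply: subgroupM; [|exact: subgroupM|exact: subgroupV].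
(* The index is positive and finite, so that it cancels in the extended reals. *)
have indexP X : exists2 r : R, (0 < r)%R &
    group_index R (centraliser (t X)) (D X) = r%:E.
  apply: (@counting_pos _ _ _ (lcoset 1 (D X))).
    exact: finite_lcosets_capr cN.
  by exists 1 => //; exact: subgroup1.
have /choice[r rP] : forall X, exists r : R, (0 < r)%R /\
    group_index R (centraliser (t X)) (D X) = r%:E.
  by move=> X; have [r r0 rE] := indexP X; exists r.
have termE X : fixed_torsion_classes phi X ->
    (1 / group_index R (centraliser (t X)) (centraliser (t X) `&` N) *
      (\esum_(Y in lcosets (centraliser (t X)) (centraliser (t X) `&` N))
        reidemeister R (centraliser (t X) `&` N)
          (inn (c X Y) \o (inn (g X) \o phi))) =
     (r X)^-1%:E * counting (twisted_orbit phi (D X) @`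
       [set x | stabiliser phi x (t X)]))%E.
  move=> fX; have [r0 rE] := rP X; congr (_ * _)%E.
    by rewrite rE div1e inver gt_eqF.
  rewrite (@esum_reidemeister_centraliser _ _ _ _ _ (g X) (c X))//.
  (* As g_t phi(t) g_t^-1 = t, the coset C_t g_t is the set of [x] with t in F_x. *)
  - have tE : t X = inn (g X) (phi (t X)) by exact: tg.
    congr counting; congr image; apply/seteqP; split=> x /=.
      move=> /centraliserP; rewrite [in Z in inn _ Z]tE inn_comp mulgVK.
      by move=> ?; apply/stabiliserP.
    move=> /stabiliserP xt; apply/centraliserP.
    by rewrite [in Z in inn _ Z]tE inn_comp mulgVK.
  - exact: nD.
  - move=> d Dd.
    have := centraliser_stable Nnormal Nphi (tg _ fX) (subgroup1 (sC X)) Dd.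
    by rewrite /= inn1.
  - by move=> Y; exact: cY.
rewrite (eq_esum termE) reidemeister_orbits.
have [finR|infR] :=
  pselect (finite_set (twisted_orbit phi [set: G] @` [set: G])); last first.
  have oo := counting_infinite R infR; rewrite oo.
  have X1 : fixed_torsion_classes phi (conj_class 1).
    split; first by exists 1 => //; exact: torsion1.
    by rewrite class_map_conj_class gmul_morph1.
  have t1 : t (conj_class 1) = 1.
    by have [h _ <-] := tX _ X1; rewrite /inn mulg1 mulgV.
  apply/esym/eqP; rewrite -leye_eq.
  apply: le_trans (le_esum1 _ X1).
  rewrite counting_orbits_infty//.
    by rewrite gt0_muley// lte_fin invr_gt0; have [] := rP (conj_class 1).
  move=> x; rewrite t1; apply/stabiliserP.
  by rewrite gmul_morph1 /inn mulg1 mulgV.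
(* Each term is split by [G]-orbits and the sums are interchanged; every [G]-orbit then has to
   contribute 1. *)
under eq_esum => X fX.
  rewrite counting_orbits_fibers// -esumZl_pos; last 2 first.
  - by rewrite invr_gt0; have [] := rP X.
  - by move=> *; exact: counting_ge0.
  over.
rewrite esum_swap; last first.
  move=> X w _ _; have [r0 _] := rP X.
  by rewrite mule_ge0 ?counting_ge0 ?lee_fin ?invr_ge0 ?ltW.
rewrite counting_esum1; apply: eq_esum => _ [x _ <-].
have xtor := stabiliser_torsion Gvpc finR (x := x).
have sF := stabiliser_subgroup phi x.
have finF : finite_set (stabiliser phi x).
  apply: (finite_capI1 sN sF cN) => h [hx Nh]; apply: Ntf; split=> //.
  exact: xtor.
have [f f0 fE] := counting_pos R finF (subgroup1 sF).
transitivity (\esum_(X in fixed_torsion_classes phi)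
    (f^-1%:E * counting (X `&` stabiliser phi x)))%E; last first.
  apply: eq_esum => X fX; have [r0 rE] := rP X.
  have := counting_orbits_stabiliser R (sD X) (@DC X) (@Dtf X) xtor.
  have -> : conj_class (t X) = X.
    have := tX _ fX; have [[s _ <-] _] := fX; by move=> /conj_class_eqP.
  (* The double count now says that f times the number of D_t-orbits is [C_t : D_t] times the number
     of elements of X in F_x. *)
  rewrite fE rE !esum_cst// => E.
  rewrite -[counting (twisted_orbit _ _ @` _)]mul1e.
  rewrite -[1%E](_ : f^-1%:E * f%:E = _)%E; last first.
    by rewrite -EFinM mulVf// gt_eqF.
  by rewrite -muleA E muleCA (muleA (r X)^-1%:E) -EFinM mulVf ?mul1e// gt_eqF.
rewrite esumZl_pos ?invr_gt0//; last by move=> *; exact: counting_ge0.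
(* The classes partition F_x, so the contribution is f / f. *)
by rewrite -counting_stabiliser_classes// fE -EFinM mulVf// gt_eqF.
Qed.
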